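(* Let $A=\mathrm{Diag}(a)\in\mathbb{R}^{n\times n}$ and let $B=\mathrm{Diag}(b)\in\mathbb{R}^{n\times n}$ be positive semi-definite, $\alpha>0$, $c,f\in\mathbb{R}^n$, with $c_i\ne0$ for all $i$. If $$\max M_i>0\quad\text{and}\quad\max N_i>0,\qquad\forall\, i=1,\dots,n,$$ then $\Pi^d(\varsigma,\sigma)$ has a unique critical point in $S^+_\sharp$, namely $$(\bar\varsigma,\bar\sigma)=(\bar\varsigma,\bar\sigma_1,\bar\sigma_2)=\left(\tfrac12\sum_{i=1}^nb_i-\alpha,\ \{\max M_i\}_{i=1}^n,\ \{\max N_i\}_{i=1}^n\right)\in S^+_\sharp,$$ which is a global maximizer of $\Pi^d(\varsigma,\sigma)$ on $S^+_\sharp$, and $$(\bar x,\bar v)=\left(\left\{\frac{c_i}{|c_i|}\right\}_{i=1}^n,\ e\right)$$ is a global minimum point of $P(x,v)$ on $\chi_v$.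
   Context: $\mathrm{Diag}(s)$ is the diagonal matrix with diagonal $s$; $e=(1,\dots,1)\in\mathbb{R}^n$; vector inequalities are componentwise. Decoupled primal problem: minimize $$P(x,v)=\tfrac12\Big(\tfrac12\sum_{i=1}^nb_ix_i^2-\alpha\Big)^2+\sum_{i=1}^n\left(\tfrac12a_ix_i^2-c_ix_i-f_iv_i\right)$$ over $\chi_v=\{(x,v)\in\mathbb{R}^n\times\{0,1\}^n : -v\le x\le v\}$. For $i=1,\dots,n$ define the two-element sets (one element for each choice of sign) $$M_i=\left\{-\tfrac12\Big(a_i+\Big(\tfrac12\sum_{j=1}^nb_j-\alpha\Big)b_i\pm c_i\Big)\right\},\qquad N_i=\left\{f_i-\tfrac12\Big(a_i+\Big(\tfrac12\sum_{j=1}^nb_j-\alpha\Big)b_i\pm c_i\Big)\right\}.$$ For $\varsigma\in\mathbb{R}$, $\sigma=(\sigma_1,\sigma_2)\in\mathbb{R}^n\times\mathbb{R}^n$, the canonical dual function is $$\Pi^d(\varsigma,\sigma)=-\tfrac12\sum_{i=1}^n\left(\frac{c_i^2}{a_i+\varsigma b_i+2(\sigma_1)_i}+\frac{\left(f_i+(\sigma_1)_i+(\sigma_2)_i\right)^2}{2(\sigma_2)_i}\right)-\tfrac12\varsigma^2-\alpha\varsigma,$$ and $$S^+_\sharp=\{(\varsigma,\sigma)\in\mathbb{R}\times\mathbb{R}^{2n} : \varsigma\ge-\alpha,\ \sigma_1\ge0,\ \sigma_2>0,\ A+\varsigma B+2\,\mathrm{Diag}(\sigma_1)\succ0\}.$$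 A critical point of $\Pi^d$ is a point where its gradient with respect to $(\varsigma,\sigma_1,\sigma_2)$ vanishes. *)

(* Defs.v *)
From HB Require Import structures.
From mathcomp Require Import all_boot all_order all_algebra.
From mathcomp Require Import all_classical all_reals all_analysis.

Set Implicit Arguments.
Unset Strict Implicit.
Unset Printing Implicit Defensive.

Import Order.TTheory GRing.Theory Num.Theory.
Import numFieldNormedType.Exports.

Local Open Scope classical_set_scope.
Local Open Scope ring_scope.

(* Symmetry is not part of these predicates; they are only applied to diagonal
   matrices. *)
Definition posdefmx (R : realType) (n : nat) (A : 'M[R]_n) : Prop :=
  forall x : 'cV[R]_n, x != 0 -> 0 < (x^T *m A *m x) ord0 ord0.

Definition possemidefmx (R : realType) (n : nat) (A : 'M[R]_n) : Prop :=
  forall x : 'cV[R]_n, 0 <= (x^T *m A *m x) ord0 ord0.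

Definition global_max_on (R : realType) (T : Type) (S : set T) (F : T -> R)
    (z : T) : Prop :=
  S z /\ forall y, S y -> F y <= F z.

Definition global_min_on (R : realType) (T : Type) (S : set T) (F : T -> R)
    (z : T) : Prop :=
  S z /\ forall y, S y -> F z <= F y.

Definition primal (R : realType) (n : nat) (a b c f : 'rV[R]_n) (alpha : R)
    (xv : 'rV[R]_n * 'rV[R]_n) : R :=
  let: (x, v) := xv in
  2^-1 * (2^-1 * (\sum_(i < n) b ord0 i * x ord0 i ^+ 2) - alpha) ^+ 2
  + \sum_(i < n) (2^-1 * a ord0 i * x ord0 i ^+ 2
                  - c ord0 i * x ord0 i - f ord0 i * v ord0 i).

Definition chi_v (R : realType) (n : nat) : set ('rV[R]_n * 'rV[R]_n) :=
  [set xv : 'rV[R]_n * 'rV[R]_n | forall i : 'I_n,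
     (xv.2 ord0 i = 0 \/ xv.2 ord0 i = 1) /\
     - xv.2 ord0 i <= xv.1 ord0 i <= xv.2 ord0 i].

(* Dual points are (varsigma, (sigma1, sigma2)); [R^o] is [R] seen as a normed
   module over itself. *)
Definition dualfun (R : realType) (n : nat) (a b c f : 'rV[R]_n) (alpha : R)
    (z : R^o * ('rV[R]_n * 'rV[R]_n)) : R^o :=
  let: (s, (s1, s2)) := z in
  - 2^-1 * (\sum_(i < n)
      (c ord0 i ^+ 2 / (a ord0 i + s * b ord0 i + 2 * s1 ord0 i)
       + (f ord0 i + s1 ord0 i + s2 ord0 i) ^+ 2 / (2 * s2 ord0 i)))
  - 2^-1 * s ^+ 2 - alpha * s.

Definition S_sharp_plus (R : realType) (n : nat) (a b : 'rV[R]_n) (alpha : R) :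
    set (R^o * ('rV[R]_n * 'rV[R]_n)) :=
  [set z : R^o * ('rV[R]_n * 'rV[R]_n) |
    [/\ - alpha <= z.1,
               forall i : 'I_n, 0 <= z.2.1 ord0 i,
               forall i : 'I_n, 0 < z.2.2 ord0 i &
               posdefmx (diag_mx a + z.1 *: diag_mx b
                         + 2 *: diag_mx z.2.1)]].

Definition gradient (R : realType) (n : nat)
    (F : R^o * ('rV[R]_n * 'rV[R]_n) -> R^o)
    (z : R^o * ('rV[R]_n * 'rV[R]_n)) : R^o * ('rV[R]_n * 'rV[R]_n) :=
  ('D_(1, (0, 0)) F z,
   (\row_(i < n) 'D_(0, (delta_mx ord0 i, 0)) F z,
    \row_(i < n) 'D_(0, (0, delta_mx ord0 i)) F z)).

(* Differentiability is required explicitly because ['D_v F z] is a total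
   operator. *)
Definition critical_point (R : realType) (n : nat)
    (F : R^o * ('rV[R]_n * 'rV[R]_n) -> R^o)
    (z : R^o * ('rV[R]_n * 'rV[R]_n)) : Prop :=
  differentiable F z /\ gradient F z = 0.

(* The two elements of M_i and of N_i are indexed by the sign [(-1) ^+ e]. *)
Definition M_elt (R : realType) (n : nat) (a b c : 'rV[R]_n) (alpha : R)
    (i : 'I_n) (e : bool) : R :=
  - 2^-1 * (a ord0 i
            + (2^-1 * (\sum_(j < n) b ord0 j) - alpha) * b ord0 i
            + (-1) ^+ e * c ord0 i).

Definition N_elt (R : realType) (n : nat) (a b c f : 'rV[R]_n) (alpha : R)
    (i : 'I_n) (e : bool) : R :=
  f ord0 i
  - 2^-1 * (a ord0 i
            + (2^-1 * (\sum_(j < n) b ord0 j) - alpha) * b ord0 i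
            + (-1) ^+ e * c ord0 i).

Definition max_M (R : realType) (n : nat) (a b c : 'rV[R]_n) (alpha : R)
    (i : 'I_n) : R :=
  Num.max (M_elt a b c alpha i false) (M_elt a b c alpha i true).

Definition max_N (R : realType) (n : nat) (a b c f : 'rV[R]_n) (alpha : R)
    (i : 'I_n) : R :=
  Num.max (N_elt a b c f alpha i false) (N_elt a b c f alpha i true).

(* Main.v *)
(* With D_i = a_i + varsigma b_i + 2 sigma_1i
   and g_i = f_i + sigma_1i, one has c_i^2 / D_i >= 2 |c_i| - D_i and
   (g_i + s)^2 / (2 s) >= 2 g_i, so the dual is bounded on S_sharp_plus by a concave
   quadratic in varsigma alone, with equality iff D_i = |c_i|, s = g_i and
   varsigma = sum b / 2 - alpha.  These three conditions are also what a vanishing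
   gradient forces, the branch s = -g_i being excluded by c_i != 0.  The common value
   bounds the primal from below by u^2 / 2 >= varsigma u - varsigma^2 / 2 with
   u = sum b_i x_i^2 / 2 - alpha, after which the problem splits into one-dimensional
   ones. *)
Require Import Defs.
From HB Require Import structures.
From mathcomp Require Import all_boot all_order all_algebra.
From mathcomp Require Import all_classical all_reals all_analysis.
From mathcomp Require Import ring lra.

Set Implicit Arguments.
Unset Strict Implicit.
Unset Printing Implicit Defensive.

Import Order.TTheory GRing.Theory Num.Theory.
Import numFieldNormedType.Exports.

Local Open Scope classical_set_scope.
Local Open Scope ring_scope.

(** * Quadratic forms of diagonal matrices *)

Lemma quad_form_diag (R : comPzRingType) (n : nat) (d : 'rV[R]_n) (x : 'cV[R]_n) :
  (x^T *m diag_mx d *m x) ord0 ord0 = \sum_(i < n) d ord0 i * x i ord0 ^+ 2.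
Proof.
rewrite mul_mx_diag mxE; apply: eq_bigr => i _.
by rewrite !mxE; ring.
Qed.

Lemma quad_form_diag_delta (R : comPzRingType) (n : nat) (d : 'rV[R]_n) (i : 'I_n) :
  let e := delta_mx i ord0 : 'cV[R]_n in
  (e^T *m diag_mx d *m e) ord0 ord0 = d ord0 i.
Proof.
rewrite /= quad_form_diag (bigD1 i) //= big1 ?mxE ?eqxx ?expr1n ?mulr1 ?addr0 //.
by move=> j ji; rewrite mxE (negPf ji) expr0n mulr0.
Qed.

Lemma possemidefmx_diag_ge0 (R : realType) (n : nat) (d : 'rV[R]_n) (i : 'I_n) :
  possemidefmx (diag_mx d) -> 0 <= d ord0 i.
Proof. by move=> /(_ (delta_mx i ord0)); rewrite quad_form_diag_delta. Qed.

Lemma posdefmx_diagP (R : realType) (n : nat) (d : 'rV[R]_n) :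
  posdefmx (diag_mx d) <-> forall i, 0 < d ord0 i.
Proof.
split=> [dP i|d_gt0 x xn0].
  have := dP (delta_mx i ord0); rewrite quad_form_diag_delta; apply.
  apply/eqP => /matrixP/(_ i ord0)/eqP.
  by rewrite !mxE !eqxx oner_eq0.
rewrite quad_form_diag lt_def sumr_ge0 ?andbT; last first.
  by move=> i _; rewrite mulr_ge0 ?sqr_ge0 // ltW.
apply: contra xn0; rewrite psumr_eq0; last first.
  by move=> i _; rewrite mulr_ge0 ?sqr_ge0 // ltW.
move=> /allP x0; apply/eqP/matrixP => i j; rewrite (ord1 j) mxE.
have := x0 i (mem_index_enum _).
by rewrite mulf_eq0 gt_eqF //= sqrf_eq0 => /eqP.
Qed.

(** * Rules for Fréchet differentials *)

(** Meant for the coordinate projections; continuity is a hypothesis because linearity alone does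
    not give it in an arbitrary normed module. *)
Lemma is_diff_linear (R : numFieldType) (V W : normedModType R) (f : V -> W) (x : V) :
  linear f -> continuous f -> is_diff x f f.
Proof.
move=> flin fcont.
pose fL : {linear V -> W} := HB.pack f (GRing.isLinear.Build _ _ _ _ _ flin).
apply: DiffDef; first exact: (@linear_differentiable _ _ _ fL).
exact: (@diff_lin _ _ _ fL).
Qed.

(** The [is_diff] combinators return sums and multiples taken in a function space; this trades them
    for pointwise formulas. *)
Lemma eq_is_diff (R : numFieldType) (V W : normedModType R)
    (f g df dg : V -> W) (x : V) :
  is_diff x f df -> f =1 g -> df =1 dg -> is_diff x g dg.
Proof. by move=> fP /funext<- /funext<-. Qed.

Lemma is_diff_sum (R : numFieldType) (V W : normedModType R) (n : nat)
    (f df : 'I_n -> V -> W) (x : V) :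
  (forall i, is_diff x (f i) (df i)) ->
  is_diff x (fun y => \sum_(i < n) f i y) (fun y => \sum_(i < n) df i y).
Proof.
move=> fP; rewrite -!fct_sumE.
by elim/big_ind2 : _ => // [|g dg h dh]; [exact: is_diff_cst|exact: is_diffD].
Qed.

Lemma is_diff_div (R : numFieldType) (V : normedModType R)
    (f g df dg : V -> R) (x : V) :
  is_diff x f df -> is_diff x g dg -> g x != 0 ->
  is_diff x (fun y => f y / g y)
    (fun v => (df v * g x - f x * dg v) / g x ^+ 2).
Proof.
move=> fP gP gx0.
have gVP : is_diff x (fun y => (g y)^-1) (- (g x) ^- 2 \*: dg).
  apply: DiffDef; first exact: differentiableV.
  by rewrite diffV // diff_val.
apply: is_diff_eq (is_diffM fP gVP) _.
by apply/funext => v /=; rewrite !fctE; do 2!rewrite /GRing.scale /=; field.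
Qed.

(** * Differential and critical points of the dual function *)

(** The coefficients of [w.1], [w.2.1] and [w.2.2] are the partial derivatives, already in the form
    in which the critical equations are solved. *)
Lemma is_diff_dualfun (R : realType) (n : nat) (a b c f : 'rV[R]_n) (alpha : R)
    (z : R^o * ('rV[R]_n * 'rV[R]_n)) (t := z.1 : R)
    (D := fun i => a ord0 i + t * b ord0 i + 2 * z.2.1 ord0 i)
    (g := fun i => f ord0 i + z.2.1 ord0 i) (s := fun i => z.2.2 ord0 i) :
  (forall i, D i != 0) -> (forall i, s i != 0) ->
  is_diff z (dualfun a b c f alpha)
    (fun w => (2^-1 * \sum_(i < n) b ord0 i * (c ord0 i / D i) ^+ 2
               - t - alpha) * (w.1 : R)
      + \sum_(i < n) ((c ord0 i / D i) ^+ 2 - (g i + s i) / (2 * s i))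
                     * w.2.1 ord0 i
      + \sum_(i < n) (g i ^+ 2 - s i ^+ 2) / (2 * s i) ^+ 2 * w.2.2 ord0 i).
Proof.
move=> D0 s0.
set V := (R^o * ('rV[R]_n * 'rV[R]_n))%type in z t D g s D0 s0 *.
have dt : is_diff z (fun y : V => y.1 : R^o) (fun w => w.1).
  by apply: is_diff_linear => // y; apply: cvg_fst.
have d1 i : is_diff z (fun y : V => y.2.1 ord0 i : R^o) (fun w => w.2.1 ord0 i).
  apply: is_diff_linear => [k u v|y]; first by rewrite /= !mxE.
  apply: (@continuous_comp _ _ _ (fun y : V => y.2.1) (fun M => M ord0 i)).
    apply: (@continuous_comp _ _ _ (fun y : V => y.2) fst).
      exact: cvg_snd.
    exact: cvg_fst.
  exact: coord_continuous.
have d2 i : is_diff z (fun y : V => y.2.2 ord0 i : R^o) (fun w => w.2.2 ord0 i).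
  apply: is_diff_linear => [k u v|y]; first by rewrite /= !mxE.
  apply: (@continuous_comp _ _ _ (fun y : V => y.2.2) (fun M => M ord0 i)).
    apply: (@continuous_comp _ _ _ (fun y : V => y.2) snd).
      exact: cvg_snd.
    exact: cvg_snd.
  exact: coord_continuous.
have dcst (k : R) : is_diff z (fun=> k : R^o) (fun=> 0) by exact: is_diff_cst.
have dD i : is_diff z
    (fun y : V => a ord0 i + (y.1 : R) * b ord0 i + 2 * y.2.1 ord0 i : R^o)
    (fun w => (w.1 : R) * b ord0 i + 2 * w.2.1 ord0 i).
  have dq := is_diffD (is_diffD (dcst (a ord0 i)) (is_diffZ (b ord0 i) dt))
                      (is_diffZ 2 (d1 i)).
  apply: (eq_is_diff dq) => [y|w].
    by rewrite !fctE [_ *: (_ : R^o)]mulrC.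
  by rewrite !fctE add0r [_ *: (_ : R^o)]mulrC.
have dT i : is_diff z
    (fun y : V => c ord0 i ^+ 2 / (a ord0 i + (y.1 : R) * b ord0 i + 2 * y.2.1 ord0 i)
       + (f ord0 i + y.2.1 ord0 i + y.2.2 ord0 i) ^+ 2 / (2 * y.2.2 ord0 i) : R^o)
    (fun w => - (c ord0 i / D i) ^+ 2 * ((w.1 : R) * b ord0 i + 2 * w.2.1 ord0 i)
       + ((g i + s i) / s i * (w.2.1 ord0 i + w.2.2 ord0 i)
         - 2 * ((g i + s i) / (2 * s i)) ^+ 2 * w.2.2 ord0 i)).
  (* [is_diffX k] concerns the power [k.+1], so the argument 1 means squaring. *)
  have dg := is_diffX 1 (is_diffD (is_diffD (dcst (f ord0 i)) (d1 i)) (d2 i)).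
  have ds := is_diffZ 2 (d2 i).
  have D0i : (fun y : V => a ord0 i + (y.1 : R) * b ord0 i + 2 * y.2.1 ord0 i : R^o) z != 0.
    exact: D0.
  have s0i : (2 *: (fun y : V => y.2.2 ord0 i : R^o)) z != 0.
    by rewrite mulf_neq0.
  have dq := is_diffD (is_diff_div (dcst (c ord0 i ^+ 2)) (dD i) D0i)
                (is_diff_div dg ds s0i).
  apply: (eq_is_diff dq) => [//|w].
  have si := s0 i; have Di := D0 i.
  rewrite !fctE /=; do 2?rewrite /GRing.scale /=.
  move: si Di; rewrite /D /g /s /t => si Di.
  by field; rewrite si Di.
have dsq := is_diffX 1 dt.
have dP := is_diffB (is_diffB (is_diffZ (- 2^-1) (is_diff_sum dT))
                            (is_diffZ 2^-1 dsq)) (is_diffZ alpha dt).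
apply: (eq_is_diff dP) => [[y [y1 y2]]|w].
  by rewrite /dualfun !fctE.
rewrite !fctE /=; have scE (k x : R) : k *: (x : R^o) = k * x by [].
rewrite !scE /=.
(* The sum is regrouped by direction; the factors 2 cancel against the prefactor [- 2^-1] of the
   dual. *)
rewrite (_ : \sum_(i < n) _ =
    - ((w.1 : R) * \sum_(i < n) b ord0 i * (c ord0 i / D i) ^+ 2)
    - 2 * (\sum_(i < n) ((c ord0 i / D i) ^+ 2 - (g i + s i) / (2 * s i))
                         * w.2.1 ord0 i)
    - 2 * (\sum_(i < n) (g i ^+ 2 - s i ^+ 2) / (2 * s i) ^+ 2
                         * w.2.2 ord0 i)).
  by rewrite /t; field.
rewrite !mulr_sumr -sumrN -!sumrB; apply: eq_bigr => i _.
by have := s0 i; have := D0 i => Di si; field; rewrite Di si.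
Qed.

(** The [sigma2] equation only yields equal squares; choosing the sign needs [c] nonzero and is left
    to the uniqueness argument. *)
Lemma critical_dualfunP (R : realType) (n : nat) (a b c f : 'rV[R]_n) (alpha : R)
    (z : R^o * ('rV[R]_n * 'rV[R]_n)) (t := z.1 : R)
    (D := fun i => a ord0 i + t * b ord0 i + 2 * z.2.1 ord0 i)
    (g := fun i => f ord0 i + z.2.1 ord0 i) (s := fun i => z.2.2 ord0 i) :
  (forall i, D i != 0) -> (forall i, s i != 0) ->
  critical_point (dualfun a b c f alpha) z <->
  [/\ 2^-1 * \sum_(i < n) b ord0 i * (c ord0 i / D i) ^+ 2 = t + alpha,
      forall i, (c ord0 i / D i) ^+ 2 = (g i + s i) / (2 * s i) &
      forall i, g i ^+ 2 = s i ^+ 2].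
Proof.
move=> D0 s0; have dF := is_diff_dualfun c f alpha D0 s0.
have F_diff : differentiable (dualfun a b c f alpha) z by exact: ex_diff.
(* A directional derivative is the differential applied to the direction, so partial derivatives are
   read off [dF] at basis vectors. *)
have derF v : 'D_v (dualfun a b c f alpha) z = _ :=
  etrans (deriveE v F_diff) (congr1 (@^~ v) diff_val).
have derF0 : 'D_(1, (0, 0)) (dualfun a b c f alpha) z
    = 2^-1 * \sum_(i < n) b ord0 i * (c ord0 i / D i) ^+ 2 - t - alpha.
  rewrite derF; cbn [fst snd]; rewrite mulr1 [X in _ + X + _]big1 ?addr0.
    by rewrite [X in _ + X]big1 ?addr0 // => i _; rewrite mxE mulr0.
  by move=> i _; rewrite mxE mulr0.
have derF1 i : 'D_(0, (delta_mx ord0 i, 0)) (dualfun a b c f alpha) z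
    = (c ord0 i / D i) ^+ 2 - (g i + s i) / (2 * s i).
  rewrite derF; cbn [fst snd]; rewrite mulr0 add0r [X in _ + X]big1 ?addr0.
    rewrite (bigD1 i) //= big1 ?addr0 ?mxE ?eqxx ?mulr1 // => j ji.
    by rewrite mxE (negPf ji) mulr0.
  by move=> j _; rewrite mxE mulr0.
have derF2 i : 'D_(0, (0, delta_mx ord0 i)) (dualfun a b c f alpha) z
    = (g i ^+ 2 - s i ^+ 2) / (2 * s i) ^+ 2.
  rewrite derF; cbn [fst snd]; rewrite mulr0 add0r [X in X + _]big1 ?add0r.
    rewrite (bigD1 i) //= big1 ?addr0 ?mxE ?eqxx ?mulr1 // => j ji.
    by rewrite mxE (negPf ji) mulr0.
  by move=> j _; rewrite mxE mulr0.
rewrite /critical_point.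
have -> : gradient (dualfun a b c f alpha) z =
    (2^-1 * \sum_(i < n) b ord0 i * (c ord0 i / D i) ^+ 2 - t - alpha,
     (\row_i ((c ord0 i / D i) ^+ 2 - (g i + s i) / (2 * s i)),
      \row_i ((g i ^+ 2 - s i ^+ 2) / (2 * s i) ^+ 2))).
  rewrite /gradient derF0; congr (_, (_, _)).
    by apply/rowP => i; rewrite [LHS]mxE [RHS]mxE; exact: derF1.
  by apply/rowP => i; rewrite [LHS]mxE [RHS]mxE; exact: derF2.
split=> [[_ [t_eq /rowP p_eq /rowP g_eq]]|[t_eq p_eq g_eq]].
  split=> [|i|i].
  - by apply/eqP; rewrite -subr_eq0 opprD addrA; apply/eqP.
  - by have := p_eq i; rewrite !mxE => /eqP; rewrite subr_eq0 => /eqP.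
  - have := g_eq i; rewrite !mxE => /eqP; rewrite mulf_eq0 subr_eq0 invr_eq0.
    by rewrite sqrf_eq0 mulf_eq0 pnatr_eq0 (negPf (s0 i)) /= orbF => /eqP.
split=> //; congr (_, (_, _)).
- by rewrite t_eq -addrA -opprD subrr.
- by apply/rowP => i; rewrite !mxE p_eq subrr.
- by apply/rowP => i; rewrite !mxE g_eq subrr mul0r.
Qed.

(** * The dual domain and the maxima in coordinates *)

(** The matrix is a linear combination of diagonal ones, hence diagonal, and its definiteness is a
    sign condition on each entry. *)
Lemma S_sharp_plusE (R : realType) (n : nat) (a b : 'rV[R]_n) (alpha : R)
    (z : R^o * ('rV[R]_n * 'rV[R]_n)) :
  S_sharp_plus a b alpha z <->
  [/\ - alpha <= z.1, forall i, 0 <= z.2.1 ord0 i, forall i, 0 < z.2.2 ord0 i &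
      forall i, 0 < a ord0 i + (z.1 : R) * b ord0 i + 2 * z.2.1 ord0 i].
Proof.
rewrite /S_sharp_plus /=.
have -> : diag_mx a + z.1 *: diag_mx b + 2 *: diag_mx z.2.1
    = diag_mx (a + (z.1 : R) *: b + 2 *: z.2.1).
  by rewrite !linearD !linearZ.
have aP : posdefmx (diag_mx (a + (z.1 : R) *: b + 2 *: z.2.1)) <->
    forall i, 0 < a ord0 i + (z.1 : R) * b ord0 i + 2 * z.2.1 ord0 i.
  by rewrite posdefmx_diagP; split=> + i => /(_ i); rewrite !mxE.
by split=> -[? ? ? /aP ?].
Qed.

(** The larger of [c] and [- c] is the absolute value. Read backwards, this says [D_i = |c_i|] at
    the claimed critical point. *)
Lemma max_ME (R : realType) (n : nat) (a b c : 'rV[R]_n) (alpha : R) (i : 'I_n) :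
  max_M a b c alpha i =
  2^-1 * (`|c ord0 i| - a ord0 i
          - (2^-1 * (\sum_(j < n) b ord0 j) - alpha) * b ord0 i).
Proof.
rewrite /max_M /M_elt expr0 expr1 maxEle; set u := _ * b ord0 i.
by case: ifP; have [?|?] := ger0P (c ord0 i); lra.
Qed.

(** [N_i] is [M_i] translated by [f_i], and translation commutes with the maximum. *)
Lemma max_NE (R : realType) (n : nat) (a b c f : 'rV[R]_n) (alpha : R) (i : 'I_n) :
  max_N a b c f alpha i = f ord0 i + max_M a b c alpha i.
Proof. by rewrite /max_N /max_M addr_maxr /N_elt /M_elt !mulNr. Qed.

(** * The common optimal value and the dual upper bound *)

(** This is the primal value at [x_i = c_i / |c_i|], [v = e], where [x_i ^+ 2 = 1] and
    [c_i * x_i = |c_i|]. *)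
Definition saddle_value (R : realType) (n : nat) (a b c f : 'rV[R]_n) (alpha : R) : R :=
  2^-1 * (2^-1 * (\sum_(i < n) b ord0 i) - alpha) ^+ 2
  + \sum_(i < n) (2^-1 * a ord0 i - `|c ord0 i| - f ord0 i).

(** After clearing the positive denominators, the two gaps are the squares of [|C| - D] and
    [g - s]. *)
Lemma dual_summand_ge (R : realType) (C D g s : R) :
  0 < D -> 0 < s -> 2 * `|C| - D + 2 * g <= C ^+ 2 / D + (g + s) ^+ 2 / (2 * s).
Proof.
move=> D0 s0; apply: lerD.
  rewrite ler_pdivlMr // -(real_normK (num_real C)).
  by have := sqr_ge0 (`|C| - D); nra.
by rewrite ler_pdivlMr ?mulr_gt0 //; have := sqr_ge0 (g - s); nra.
Qed.

Lemma dualfun_le (R : realType) (n : nat) (a b c f : 'rV[R]_n) (alpha : R)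
    (z : R^o * ('rV[R]_n * 'rV[R]_n)) :
  S_sharp_plus a b alpha z ->
  dualfun a b c f alpha z <= saddle_value a b c f alpha.
Proof.
case: z => t [s1 s2] /S_sharp_plusE[/= _ _ s2_gt0 D_gt0].
rewrite /saddle_value.
have : \sum_(i < n) (2 * `|c ord0 i|
         - (a ord0 i + (t : R) * b ord0 i + 2 * s1 ord0 i)
         + 2 * (f ord0 i + s1 ord0 i))
     <= \sum_(i < n) (c ord0 i ^+ 2 / (a ord0 i + (t : R) * b ord0 i + 2 * s1 ord0 i)
       + (f ord0 i + s1 ord0 i + s2 ord0 i) ^+ 2 / (2 * s2 ord0 i)).
  by apply: ler_sum => i _; apply: dual_summand_ge.
(* In the lower bound [sigma1] cancels between [- D_i] and [2 g_i], leaving only [t]. *)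
rewrite (eq_bigr (fun i => - 2 * (2^-1 * a ord0 i - `|c ord0 i| - f ord0 i)
                           - (t : R) * b ord0 i)); last by move=> i _; field.
rewrite sumrB -!mulr_sumr.
(* Completing the square in [t] around the maximizer of the remaining concave quadratic. *)
have := sqr_ge0 ((t : R) - (2^-1 * \sum_(i < n) b ord0 i - alpha)).
set T := \sum_(i < n) (_ / _ + _); set S := \sum_(i < n) b _ _.
set U := \sum_(i < n) _; move: (t : R) T S U => u T S U; nra.
Qed.

Lemma sqr_div_norm (R : realType) (x : R) : x != 0 -> x ^+ 2 / `|x| = `|x|.
Proof. by move=> x0; rewrite -real_normK ?num_real // expr2 mulfK ?normr_eq0. Qed.

(** Equality case of [dualfun_le]: each summand and the quadratic in [t] attain their bounds. *)
Lemma dualfun_saddle (R : realType) (n : nat) (a b c f : 'rV[R]_n) (alpha : R)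
    (z : R^o * ('rV[R]_n * 'rV[R]_n)) :
  (forall i, c ord0 i != 0) ->
  z.1 = 2^-1 * (\sum_(i < n) b ord0 i) - alpha ->
  (forall i, a ord0 i + (z.1 : R) * b ord0 i + 2 * z.2.1 ord0 i = `|c ord0 i|) ->
  (forall i, f ord0 i + z.2.1 ord0 i = z.2.2 ord0 i) ->
  (forall i, 0 < z.2.2 ord0 i) ->
  dualfun a b c f alpha z = saddle_value a b c f alpha.
Proof.
case: z => t [s1 s2] /= c0 tE DE gE s_gt0; rewrite /saddle_value.
rewrite (eq_bigr (fun i => - 2 * (2^-1 * a ord0 i - `|c ord0 i| - f ord0 i)
                           - (t : R) * b ord0 i)).
  by rewrite sumrB -!mulr_sumr tE; field.
move=> i _; rewrite DE gE sqr_div_norm //.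
have -> : (s2 ord0 i + s2 ord0 i) ^+ 2 / (2 * s2 ord0 i) = 2 * s2 ord0 i.
  by field; rewrite gt_eqF.
by have := DE i; have := gE i; lra.
Qed.

(** * The primal lower bound *)

(** Here [m] stands for [max_M] and [f + m] for [max_N]; the coefficient [|C| - 2 * m] is then
    [a_i + varsigma b_i]. *)
Lemma primal_summand_ge (R : realType) (C m f x v : R) :
  0 < m -> 0 < f + m -> v = 0 \/ v = 1 -> - v <= x <= v ->
  2^-1 * `|C| - m - `|C| - f <= 2^-1 * (`|C| - 2 * m) * x ^+ 2 - C * x - f * v.
Proof.
move=> m_gt0 fm_gt0 [->|->] /andP[x_ge x_le].
  (* For [v = 0] the claim reduces to [0 <= |C| / 2 + (f + m)]. *)
  have -> : x = 0 by lra.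
  by have := normr_ge0 C; lra.
have : C * x <= `|C| * `|x| by rewrite -normrM ler_norm.
have x1 : `|x| <= 1 by rewrite ler_norml x_ge.
rewrite -(real_normK (num_real x)).
move: `|x| `|C| (normr_ge0 x) (normr_ge0 C) x1 => y k y_ge0 k_ge0 y1.
(* Once [C * x] is replaced by its bound [k * y], the gap is
   [k * (1 - y) ^+ 2 / 2 + m * (1 - y ^+ 2)]. *)
have : 0 <= k * (1 - y) ^+ 2 by rewrite mulr_ge0 ?sqr_ge0.
have : 0 <= m * (1 - y ^+ 2).
  by rewrite mulr_ge0 ?subr_ge0 ?expr_le1 // ltW.
by lra.
Qed.

Lemma primal_ge (R : realType) (n : nat) (a b c f : 'rV[R]_n) (alpha : R)
    (xv : 'rV[R]_n * 'rV[R]_n) :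
  (forall i : 'I_n, 0 < max_M a b c alpha i /\ 0 < max_N a b c f alpha i) ->
  chi_v xv -> saddle_value a b c f alpha <= primal a b c f alpha xv.
Proof.
case: xv => x v MN_gt0 xvP; rewrite /saddle_value /=.
set S := \sum_(i < n) b ord0 i.
have : \sum_(i < n) (2^-1 * a ord0 i + 2^-1 * (2^-1 * S - alpha) * b ord0 i
                     - `|c ord0 i| - f ord0 i)
    <= \sum_(i < n) (2^-1 * (a ord0 i + (2^-1 * S - alpha) * b ord0 i) * x ord0 i ^+ 2
                     - c ord0 i * x ord0 i - f ord0 i * v ord0 i).
  apply: ler_sum => i _; have [M_gt0 N_gt0] := MN_gt0 i; have [vi xi] := xvP i.
  rewrite max_NE in N_gt0.
  have := primal_summand_ge (c ord0 i) M_gt0 N_gt0 vi xi.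
  by rewrite max_ME -/S; lra.
rewrite (eq_bigr (fun i => (2^-1 * a ord0 i - `|c ord0 i| - f ord0 i)
    + 2^-1 * (2^-1 * S - alpha) * b ord0 i)); last by move=> i _; ring.
rewrite big_split /= -mulr_sumr -/S.
rewrite [leRHS](eq_bigr (fun i => (2^-1 * a ord0 i * x ord0 i ^+ 2
      - c ord0 i * x ord0 i - f ord0 i * v ord0 i)
    + 2^-1 * (2^-1 * S - alpha) * (b ord0 i * x ord0 i ^+ 2)));
  last by move=> i _; ring.
rewrite [leRHS]big_split /= -mulr_sumr.
set Q := \sum_(i < n) b ord0 i * _; set U := \sum_(i < n) _.
set W := \sum_(i < n) _; move: Q U W S => Q U W S.
(* The convex function [u ^+ 2 / 2] lies above its tangent at [2^-1 * S - alpha]. *)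
have := sqr_ge0 ((2^-1 * Q - alpha) - (2^-1 * S - alpha)).
by nra.
Qed.

(** * Optimality and uniqueness *)

Theorem theorem7 (R : realType) (n : nat) (a b c f : 'rV[R]_n) (alpha : R)
    (hB : possemidefmx (diag_mx b)) (halpha : 0 < alpha)
    (hc : forall i : 'I_n, c ord0 i != 0)
    (hMN : forall i : 'I_n, 0 < max_M a b c alpha i /\ 0 < max_N a b c f alpha i) :
  let zbar : R^o * ('rV[R]_n * 'rV[R]_n) :=
    (2^-1 * (\sum_(i < n) b ord0 i) - alpha,
     (\row_(i < n) max_M a b c alpha i, \row_(i < n) max_N a b c f alpha i)) in
  let xbar : 'rV[R]_n := \row_(i < n) (c ord0 i / `|c ord0 i|) in
  [/\ S_sharp_plus a b alpha zbar /\ critical_point (dualfun a b c f alpha) zbar,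
      forall z, S_sharp_plus a b alpha z ->
        critical_point (dualfun a b c f alpha) z -> z = zbar,
      global_max_on (S_sharp_plus a b alpha) (dualfun a b c f alpha) zbar &
      global_min_on (@chi_v R n) (primal a b c f alpha) (xbar, const_mx 1)].
Proof.
move=> zbar xbar.
have c_gt0 i : 0 < `|c ord0 i| by rewrite normr_gt0.
have c_sqr i : (c ord0 i / `|c ord0 i|) ^+ 2 = 1.
  by rewrite expr_div_n real_normK ?num_real // divff ?sqrf_eq0.
have double_frac (s : R) : 0 < s -> (s + s) / (2 * s) = 1.
  by move=> s_gt0; field; rewrite gt_eqF.
have D_zbar i : a ord0 i + (zbar.1 : R) * b ord0 i + 2 * zbar.2.1 ord0 i = `|c ord0 i|.
  by rewrite /zbar /= mxE max_ME; field.
have g_zbar i : f ord0 i + zbar.2.1 ord0 i = zbar.2.2 ord0 i.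
  by rewrite /zbar /= !mxE max_NE.
have s_zbar i : 0 < zbar.2.2 ord0 i by rewrite /zbar /= mxE; have [] := hMN i.
have zbarS : S_sharp_plus a b alpha zbar.
  apply/S_sharp_plusE; split=> // [|i|i]; last by rewrite D_zbar.
    (* The bound by [- alpha] amounts to a nonnegative sum of the [b_i], the diagonal entries of a
       semidefinite matrix. *)
    rewrite /zbar /= lerDr mulr_ge0 ?invr_ge0 // sumr_ge0 // => i _.
    exact: possemidefmx_diag_ge0.
  by rewrite /zbar /= mxE ltW //; have [] := hMN i.
have dual_zbar : dualfun a b c f alpha zbar = saddle_value a b c f alpha.
  exact: dualfun_saddle.
split.
- split=> //; apply/critical_dualfunP => [i|i|].
  + by rewrite D_zbar gt_eqF.
  + by rewrite gt_eqF.
  split=> [|i|i].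
  + under eq_bigr do rewrite D_zbar c_sqr mulr1.
    by rewrite /zbar /= subrK.
  + by rewrite D_zbar c_sqr g_zbar double_frac.
  + by rewrite g_zbar.
- move=> z zS zcrit; have [_ _ s_gt0 D_gt0] := (S_sharp_plusE _ _ _ _).1 zS.
  have D_neq0 i : a ord0 i + (z.1 : R) * b ord0 i + 2 * z.2.1 ord0 i != 0.
    by rewrite gt_eqF.
  have s_neq0 i : z.2.2 ord0 i != 0 by rewrite gt_eqF.
  have [t_eq p_eq g_eq] := (critical_dualfunP c f alpha D_neq0 s_neq0).1 zcrit.
  have gi i : f ord0 i + z.2.1 ord0 i = z.2.2 ord0 i.
    (* The root [g_i = - s_i] would make [(c_i / D_i) ^+ 2] vanish. *)
    have /eqP := g_eq i; rewrite eqf_sqr => /orP[/eqP //|/eqP gN].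
    have := p_eq i; rewrite gN addNr mul0r => /eqP.
    by rewrite sqrf_eq0 mulf_eq0 (negPf (hc i)) invr_eq0 gt_eqF.
  have Di i : a ord0 i + (z.1 : R) * b ord0 i + 2 * z.2.1 ord0 i = `|c ord0 i|.
    have := p_eq i; rewrite gi double_frac //.
    (* Now [c_i ^+ 2 = D_i ^+ 2], and positivity of [D_i] selects the root [|c_i|]. *)
    rewrite expr_div_n => /divr1_eq cD.
    by apply/eqP; rewrite -(@eqrXn2 _ 2) ?ltW // real_normK ?num_real // cD.
  have t_val : z.1 = zbar.1.
    move: t_eq; under eq_bigr do rewrite Di c_sqr mulr1.
    by rewrite /zbar /= => ->; rewrite addrK.
  have s1_val : z.2.1 = zbar.2.1.
    (* With [varsigma] known, [D_i] determines [sigma1]. *)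
    apply/rowP => i; have := Di i; rewrite -(D_zbar i) t_val.
    by move=> /addrI/mulfI; apply.
  have s2_val : z.2.2 = zbar.2.2.
    by apply/rowP => i; rewrite -gi -g_zbar s1_val.
  by rewrite [LHS]surjective_pairing [z.2]surjective_pairing t_val s1_val s2_val.
- by split=> // z zS; rewrite dual_zbar; exact: dualfun_le.
split=> [i|xv xvP].
  rewrite /= !mxE; split; first by right.
  by rewrite -ler_norml normf_div normr_id divff ?gt_eqF.
(* There is no duality gap: the candidate attains the lower bound of [primal_ge]. *)
suff -> : primal a b c f alpha (xbar, const_mx 1) = saddle_value a b c f alpha.
  exact: primal_ge.
rewrite /primal /saddle_value; congr (_ * (_ * _ - _) ^+ 2 + _).
  by apply: eq_bigr => i _; rewrite mxE c_sqr mulr1.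
apply: eq_bigr => i _; rewrite !mxE c_sqr !mulr1 mulrA -expr2; congr (_ - _ - _).
exact: sqr_div_norm.
Qed.
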